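(* Let $a,b$ be complex numbers with $|\operatorname{Re} b|<\operatorname{Re} a$. Then $$\int_0^\infty \frac{\cosh bx}{\sinh ax}\,x\,dx=\frac{\pi^2}{4a^2}\,\frac{1}{\sin^2\!\left(\frac{\pi}{2}\left(1+\frac{b}{a}\right)\right)}=\frac{\pi^2}{4a^2}\,\frac{1}{\cos^2\!\left(\pi b/(2a)\right)}.$$ *)

(* Defs.v *)
From Stdlib Require Import Reals.
From Coquelicot Require Import Coquelicot.

Open Scope R_scope.

Definition Cexp (z : C) : C :=
  (exp (Re z) * cos (Im z), exp (Re z) * sin (Im z)).

Definition Ccosh (z : C) : C := ((Cexp z + Cexp (- z)) / 2)%C.
Definition Csinh (z : C) : C := ((Cexp z - Cexp (- z)) / 2)%C.
Definition Ccos (z : C) : C := ((Cexp (Ci * z) + Cexp (- (Ci * z))) / 2)%C.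
Definition Csin (z : C) : C :=
  ((Cexp (Ci * z) - Cexp (- (Ci * z))) / (2 * Ci))%C.

(* Convergent improper integral over the open half-line (0, +oo): the value of
   f at 0 is irrelevant, and both end points are limits, so that an integrand
   with a (removable) singularity at 0 needs no separate value there. *)
Definition is_CInt_0_infty (f : R -> C) (v : C) : Prop :=
  is_RInt_gen (V := C_R_NormedModule) f
    (at_right 0) (Rbar_locally p_infty) v.

(* Main.v *)
(* Writing [1/sinh(ax)] as a geometric series with [N] terms, [x cosh(bx)/sinh(ax)]
   is the sum of [x exp(-sx)] over [s = (2k+1)a + b] and [s = (2k+1)a - b], [k < N],
   plus the remainder [x cosh(bx)/sinh(ax) exp(-2Nax)], whose integral is O(1/N).
   As [x exp(-sx)] integrates to [1/s^2], it remains to sum the series of the [1/s^2].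
   Along [N = 2^n] this follows from iterating
   [1/sin^2 s = (1/sin^2 (s/2) + 1/sin^2 ((s+pi)/2)) / 4]: the value is
   [4^-(n+1)] times a sum of [2^(n+1)] terms [1/sin^2 w], and since [1/sin^2 w - 1/w^2]
   is bounded for [|w| <= 5 pi/6], replacing each of them by [1/w^2] costs only O(2^-n). *)
Require Import Defs.
From Stdlib Require Import Reals.
From Coquelicot Require Import Coquelicot.
From Stdlib Require Import Lra Lia.
Open Scope R_scope.

(** A subsequence of N is enough because, for every N, the remainder estimate approximates the same
    integral, uniformly in its end points; powers of two are the values that the halving formula
    produces. The obstacle is that 1/sin^2 w - 1/w^2 is bounded only away from the nonzero multiples
    of pi, while the angles produced by halving are spread over an interval of length pi. Shifting
    the upper half of them by -pi makes them symmetric: they become h (z + j) and h (z - j) with z =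
    b/a, h = pi/(4 * 2^n) and j odd, j < 2 * 2^n. Once |z| <= 2^n they have modulus at most 3 pi/4,
    inside the disc of radius 5 pi/6. That radius is chosen because sin (5 pi/6) = 1/2 makes the
    lower bound on |sin| explicit. All estimates reduce to real calculus, applied to complex
    functions of one real variable. *)

(** * Complex exponential, sine and cosine *)

Lemma exp_increasing_le (x y : R) : x <= y -> exp x <= exp y.
Proof. intros [H | ->]; [left; apply exp_increasing | right]; auto. Qed.

Lemma Cexp_0 : Cexp 0 = 1.
Proof. unfold Cexp; simpl; rewrite exp_0, cos_0, sin_0; apply injective_projections; simpl; ring. Qed.

Lemma Cexp_plus (z w : C) : Cexp (z + w) = (Cexp z * Cexp w)%C.
Proof.
  destruct z as [x y], w as [x' y']. unfold Cexp; simpl.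
  rewrite exp_plus, cos_plus, sin_plus. apply injective_projections; simpl; ring.
Qed.

Lemma Cmod_Cexp (z : C) : Cmod (Cexp z) = exp (Re z).
Proof.
  unfold Cmod, Cexp; simpl.
  replace (_ + _) with ((exp (Re z)) ^ 2 * (Rsqr (sin (Im z)) + Rsqr (cos (Im z))))
    by (unfold Rsqr; ring).
  rewrite sin2_cos2, Rmult_1_r. apply sqrt_pow2, Rlt_le, exp_pos.
Qed.

Lemma Cexp_neq_0 (z : C) : Cexp z <> 0.
Proof. apply Cmod_gt_0. rewrite Cmod_Cexp. apply exp_pos. Qed.

Lemma Cexp_opp (z : C) : Cexp (- z) = (/ Cexp z)%C.
Proof.
  assert (H : (Cexp z * Cexp (- z) = 1)%C).
  { rewrite <- Cexp_plus, <- Cexp_0. f_equal. ring. }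
  rewrite <- (Cmult_1_l (/ Cexp z)), <- H. field. apply Cexp_neq_0.
Qed.

Lemma Csin_plus (z w : C) : Csin (z + w) = (Csin z * Ccos w + Ccos z * Csin w)%C.
Proof.
  unfold Csin, Ccos. rewrite Cmult_plus_distr_l, !Cexp_opp, !Cexp_plus.
  field. repeat split; try apply Cexp_neq_0. apply Ci_nz.
Qed.

Lemma Csin_sqr_plus_Ccos_sqr (z : C) : (Csin z ^ 2 + Ccos z ^ 2 = 1)%C.
Proof.
  unfold Csin, Ccos. rewrite !Cexp_opp.
  replace (2 * Ci)%C with (Ci * 2)%C by ring.
  (* [field] treats [Ci] as an indeterminate, so i^2 = -1 has to be substituted by hand. *)
  assert (H : (Ci * Ci = -1)%C) by (apply injective_projections; simpl; ring).
  replace (((Cexp (Ci * z) - / Cexp (Ci * z)) / (Ci * 2)) ^ 2)%C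
    with (- ((Cexp (Ci * z) - / Cexp (Ci * z)) / 2) ^ 2)%C.
  - field. apply Cexp_neq_0.
  - replace (((Cexp (Ci * z) - / Cexp (Ci * z)) / (Ci * 2)) ^ 2)%C
      with (((Cexp (Ci * z) - / Cexp (Ci * z)) / 2) ^ 2 / (Ci * Ci))%C.
    + rewrite H. field. apply Cexp_neq_0.
    + field. split; [apply Cexp_neq_0 | apply Ci_nz].
Qed.

Lemma Csin_RtoC (x : R) : Csin x = sin x.
Proof.
  unfold Csin, Cexp; simpl.
  apply injective_projections; simpl;
  rewrite ?(cos_neg), ?sin_neg;
  replace (0 * x - 1 * 0) with 0 by ring; rewrite Ropp_0, exp_0;
  replace (- (0 * 0 + 1 * x)) with (- x) by ring; rewrite ?cos_neg, ?sin_neg;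
  replace (0 * 0 + 1 * x) with x by ring; field.
Qed.

Lemma Ccos_RtoC (x : R) : Ccos x = cos x.
Proof.
  unfold Ccos, Cexp; simpl.
  apply injective_projections; simpl;
  replace (0 * x - 1 * 0) with 0 by ring; rewrite Ropp_0, exp_0;
  replace (- (0 * 0 + 1 * x)) with (- x) by ring; rewrite ?cos_neg, ?sin_neg;
  replace (0 * 0 + 1 * x) with x by ring; field.
Qed.

Lemma Csin_plus_PI2 (z : C) : Csin (z + PI / 2) = Ccos z.
Proof.
  rewrite <- RtoC_div by lra.
  rewrite Csin_plus, Csin_RtoC, Ccos_RtoC, sin_PI2, cos_PI2. ring.
Qed.

Lemma Csin_minus_PI (z : C) : Csin (z - PI) = (- Csin z)%C.
Proof.
  unfold Cminus. rewrite <- RtoC_opp, Csin_plus, Csin_RtoC, Ccos_RtoC, sin_neg, cos_neg, sin_PI, cos_PI.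
  rewrite Ropp_0. ring.
Qed.

Lemma Csin_double (z : C) : Csin (2 * z) = (2 * Csin z * Ccos z)%C.
Proof. replace (2 * z)%C with (z + z)%C by ring. rewrite Csin_plus. ring. Qed.

(** * Modulus of the complex sine: lower bound and zeros *)

Lemma Cmod_sqr (z : C) : Cmod z ^ 2 = Re z ^ 2 + Im z ^ 2.
Proof. unfold Cmod. rewrite pow2_sqrt. reflexivity. simpl; unfold Re, Im; nra. Qed.

(** The last term is sinh^2 (Im z). This separation of the real and imaginary parts yields both the
    lower bound on |sin| and the location of its zeros. *)
Lemma Cmod_Csin_sqr (z : C) :
  Cmod (Csin z) ^ 2 = sin (Re z) ^ 2 + ((exp (Im z) - exp (- Im z)) / 2) ^ 2.
Proof.
  destruct z as [x y]. unfold Csin. rewrite Cmod_div, Cmod_mult.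
  2:{ apply Cmult_neq_0. intros E; apply RtoC_inj in E; lra. apply Ci_nz. }
  replace (Cmod Ci) with 1.
  2:{ unfold Cmod, Ci; simpl. symmetry. replace (_ + _) with 1 by ring. apply sqrt_1. }
  rewrite Cmod_R, Rabs_pos_eq by lra.
  unfold Rdiv. rewrite Rpow_mult_distr, Cmod_sqr. unfold Cexp; simpl.
  replace (0 * x - 1 * y) with (- y) by ring. replace (0 * y + 1 * x) with x by ring.
  rewrite Ropp_involutive, cos_neg, sin_neg, exp_Ropp.
  assert (H := exp_pos y). assert (Hs := sin2_cos2 x). unfold Rsqr in Hs.
  assert (Hc : cos x * cos x = 1 - sin x * sin x) by lra.
  set (e := exp y) in *.
  transitivity (((/ e - e) ^ 2 * (cos x * cos x) + (/ e + e) ^ 2 * (sin x * sin x)) / 4).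
  field; lra. rewrite Hc. field. lra.
Qed.

(** Up to pi/3 the derivative is at least 1/2, so sin x >= x/2. From there to 5 pi/6 the sine is at
    least 1/2, while x/7 <= 10/21 because pi <= 4. *)
Lemma sin_ge_seventh (x : R) : 0 <= x <= 5 * PI / 6 -> x / 7 <= sin x.
Proof.
  intros [H0 H1]. assert (Hpi := PI_RGT_0). assert (Hpi4 := PI_4).
  assert (H6 := sin_PI6).
  destruct (Rle_lt_dec x (PI / 3)) as [Hx|Hx].
  - destruct (MVT_gen sin 0 x cos) as [c [Hc E]].
    + intros; auto_derive; [trivial | ring].
    + intros; apply continuity_sin.
    + rewrite Rmin_left, Rmax_right in Hc by lra. rewrite sin_0 in E.
      assert (1 / 2 <= cos c) by (rewrite <- cos_PI3; apply cos_decr_1; lra). nra.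
  - assert (1 / 2 <= sin x); [|lra]. rewrite <- H6.
    destruct (Rle_lt_dec x (PI / 2)).
    + apply sin_incr_1; lra.
    + rewrite <- (sin_PI_x x). apply sin_incr_1; lra.
Qed.

(** The two squares in |sin z|^2 are bounded separately: sin^2 (Re z) by the real case, as |Re z| <=
    |z|, and sinh^2 (Im z) >= (Im z / 2)^2 from e^y >= 1 + y and e^(-y) <= 1 for y >= 0. *)
Lemma Cmod_Csin_ge (z : C) : Cmod z <= 5 * PI / 6 -> Cmod z / 7 <= Cmod (Csin z).
Proof.
  intros Hz. assert (Hr := re_le_Cmod z).
  apply Rsqr_incr_0_var; [|apply Cmod_ge_0]. rewrite !Rsqr_pow2, Cmod_Csin_sqr.
  unfold Rdiv; rewrite Rpow_mult_distr, Cmod_sqr.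
  assert (Hs : (Re z / 7) ^ 2 <= sin (Re z) ^ 2).
  { destruct (Rle_dec 0 (Re z)).
    - rewrite Rabs_pos_eq in Hr by lra. assert (H := sin_ge_seventh (Re z)). apply pow_incr; lra.
    - rewrite Rabs_left in Hr by lra. assert (H := sin_ge_seventh (- Re z)).
      rewrite sin_neg in H. replace (sin (Re z) ^ 2) with ((- sin (Re z)) ^ 2) by ring.
      replace ((Re z / 7) ^ 2) with ((- Re z / 7) ^ 2) by field. apply pow_incr; lra. }
  assert (Hh : (Im z / 2) ^ 2 <= ((exp (Im z) - exp (- Im z)) / 2) ^ 2).
  { assert (H1 := exp_ineq1_le (Im z)). assert (H2 := exp_ineq1_le (- Im z)).
    destruct (Rle_dec 0 (Im z)).
    - assert (exp (- Im z) <= 1) by (rewrite <- exp_0; apply exp_increasing_le; lra).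
      apply pow_incr; lra.
    - assert (exp (Im z) <= 1) by (rewrite <- exp_0; apply exp_increasing_le; lra).
      replace ((Im z / 2) ^ 2) with ((- Im z / 2) ^ 2) by field.
      replace (((exp (Im z) - exp (- Im z)) / 2) ^ 2) with (((exp (- Im z) - exp (Im z)) / 2) ^ 2) by field.
      apply pow_incr; lra. }
  unfold Rdiv in *. nra.
Qed.

(** Both squares in |sin z|^2 vanish: the hyperbolic one forces Im z = 0, the other one is the real
    case. *)
Lemma Csin_eq_0 (z : C) : Csin z = 0 -> exists k : Z, z = (IZR k * PI)%C.
Proof.
  intros H. assert (E := Cmod_Csin_sqr z). rewrite H, Cmod_0 in E.
  assert (H1 := pow2_ge_0 (sin (Re z))).
  assert (H2 := pow2_ge_0 ((exp (Im z) - exp (- Im z)) / 2)).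
  assert (E1 : sin (Re z) = 0) by (apply Rsqr_0_uniq; rewrite Rsqr_pow2; lra).
  assert (E2 : (exp (Im z) - exp (- Im z)) / 2 = 0)
    by (apply Rsqr_0_uniq; rewrite Rsqr_pow2; lra).
  assert (E3 : exp (Im z) = exp (- Im z)) by lra.
  apply exp_inv in E3. destruct (sin_eq_0_0 _ E1) as [k Hk]. exists k.
  destruct z as [x y]; simpl in *. rewrite <- RtoC_mult. unfold RtoC. f_equal; lra.
Qed.

(** * Differentiation of complex functions of a real variable *)

(** Stated by components, so that the real mean value theorem and the real fundamental theorem of
    calculus apply directly. *)
Definition is_Cderive (F : R -> C) (t : R) (l : C) : Prop :=
  is_derive (fun u => Re (F u)) t (Re l) /\ is_derive (fun u => Im (F u)) t (Im l).

Lemma is_Cderive_eq (F : R -> C) (t : R) (l l' : C) :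
  is_Cderive F t l -> l = l' -> is_Cderive F t l'.
Proof. intros H <-; exact H. Qed.

Lemma is_Cderive_ext (F G : R -> C) (t : R) (l : C) :
  (forall u, F u = G u) -> is_Cderive F t l -> is_Cderive G t l.
Proof.
  intros E [H1 H2]; split; [refine (is_derive_ext _ _ _ _ _ H1) | refine (is_derive_ext _ _ _ _ _ H2)];
  intros u; simpl; rewrite E; reflexivity.
Qed.

Lemma is_Cderive_const (c : C) (t : R) : is_Cderive (fun _ => c) t 0.
Proof. split; simpl; auto_derive; auto. Qed.

Lemma is_Cderive_RtoC (t : R) : is_Cderive RtoC t 1.
Proof. split; simpl; auto_derive; auto. Qed.

Lemma is_Cderive_plus (F G : R -> C) (t : R) (l m : C) :
  is_Cderive F t l -> is_Cderive G t m -> is_Cderive (fun u => F u + G u)%C t (l + m)%C.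
Proof.
  intros [H1 H2] [H3 H4]; split;
  [exact (is_derive_plus _ _ _ _ _ H1 H3) | exact (is_derive_plus _ _ _ _ _ H2 H4)].
Qed.

Lemma is_Cderive_opp (F : R -> C) (t : R) (l : C) :
  is_Cderive F t l -> is_Cderive (fun u => - F u)%C t (- l)%C.
Proof.
  intros [H1 H2]; split; [exact (is_derive_opp _ _ _ H1) | exact (is_derive_opp _ _ _ H2)].
Qed.

Lemma is_Cderive_mult (F G : R -> C) (t : R) (l m : C) :
  is_Cderive F t l -> is_Cderive G t m ->
  is_Cderive (fun u => F u * G u)%C t (l * G t + F t * m)%C.
Proof.
  intros [H1 H2] [H3 H4].
  assert (D : forall (p q : R -> R) (dp dq : R), is_derive p t dp -> is_derive q t dq ->
    is_derive (fun u => p u * q u) t (dp * q t + p t * dq)).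
  { intros p q dp dq Hp Hq. exact (is_derive_mult p q t dp dq Hp Hq Rmult_comm). }
  split.
  - replace (Re (l * G t + F t * m))
      with ((Re l * Re (G t) + Re (F t) * Re m) - (Im l * Im (G t) + Im (F t) * Im m))
      by (simpl; unfold Re, Im; ring).
    exact (is_derive_minus _ _ _ _ _ (D _ _ _ _ H1 H3) (D _ _ _ _ H2 H4)).
  - replace (Im (l * G t + F t * m))
      with ((Re l * Im (G t) + Re (F t) * Im m) + (Im l * Re (G t) + Im (F t) * Re m))
      by (simpl; unfold Re, Im; ring).
    exact (is_derive_plus _ _ _ _ _ (D _ _ _ _ H1 H4) (D _ _ _ _ H2 H3)).
Qed.

Lemma is_Cderive_inv (F : R -> C) (t : R) (l : C) :
  is_Cderive F t l -> F t <> 0 -> is_Cderive (fun u => / F u)%C t (- l / (F t * F t))%C.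
Proof.
  intros [H1 H2] H0.
  assert (Hn : Re (F t) ^ 2 + Im (F t) ^ 2 <> 0).
  { intros E. apply H0. apply injective_projections; simpl; unfold Re, Im in E; nra. }
  (* Both components of 1/(p + iq) have this shape: (c, d) = (1, 0) for the real part and (0, -1)
     for the imaginary part. *)
  assert (D : forall (p q : R -> R) (dp dq : R), is_derive p t dp -> is_derive q t dq ->
    p t ^ 2 + q t ^ 2 <> 0 -> forall c d,
    is_derive (fun u => (c * p u + d * q u) / (p u ^ 2 + q u ^ 2)) t
      (((c * dp + d * dq) * (p t ^ 2 + q t ^ 2)
        - (c * p t + d * q t) * (2 * p t * dp + 2 * q t * dq)) / (p t ^ 2 + q t ^ 2) ^ 2)).
  { intros p q dp dq Hp Hq Hpq c d. auto_derive.
    - repeat split; try (eexists; eassumption). exact Hpq.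
    - rewrite (is_derive_unique (fun x : R => p x) t dp Hp), (is_derive_unique (fun x : R => q x) t dq Hq).
      field. exact Hpq. }
  (* Multiplying by conj(F)^2 makes the denominator the real number |F|^4, so that the components
     can be read off. *)
  assert (E : (- l / (F t * F t) =
    - (l * (Cconj (F t) * Cconj (F t))) * / RtoC ((Re (F t) ^ 2 + Im (F t) ^ 2) ^ 2))%C).
  { rewrite RtoC_pow, <- Cmod_sqr, Cmod2_conj. field. split; [|exact H0].
    intros Hc. apply H0. rewrite <- (Cconj_conj (F t)), Hc. apply injective_projections; simpl; ring. }
  rewrite E, <- RtoC_inv by (apply pow_nonzero; exact Hn).
  split.
  - eapply is_derive_ext; [|eapply eq_rect; [exact (D _ _ _ _ H1 H2 Hn 1 0)|]].
    + intros u; simpl; unfold Re, Im, Rdiv; f_equal; ring.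
    + simpl; unfold Re, Im in *; field; intros H; apply Hn; rewrite <- H; ring.
  - eapply is_derive_ext; [|eapply eq_rect; [exact (D _ _ _ _ H1 H2 Hn 0 (-1))|]].
    + intros u; simpl; unfold Re, Im, Rdiv; f_equal; ring.
    + simpl; unfold Re, Im in *; field; intros H; apply Hn; rewrite <- H; ring.
Qed.

Lemma is_Cderive_Cexp (F : R -> C) (t : R) (l : C) :
  is_Cderive F t l -> is_Cderive (fun u => Cexp (F u)) t (l * Cexp (F t))%C.
Proof.
  intros [H1 H2].
  assert (D : forall (p q : R -> R) (dp dq : R), is_derive p t dp -> is_derive q t dq ->
    is_derive (fun u => exp (p u) * cos (q u)) t (exp (p t) * (dp * cos (q t) - dq * sin (q t))) /\
    is_derive (fun u => exp (p u) * sin (q u)) t (exp (p t) * (dp * sin (q t) + dq * cos (q t)))).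
  { intros p q dp dq Hp Hq.
    split; auto_derive; try (repeat split; eexists; eassumption);
    rewrite (is_derive_unique (fun x : R => p x) t dp Hp),
      (is_derive_unique (fun x : R => q x) t dq Hq); ring. }
  destruct (D _ _ _ _ H1 H2) as [D1 D2]. split.
  - eapply eq_rect; [exact D1|]. simpl; unfold Re, Im; ring.
  - eapply eq_rect; [exact D2|]. simpl; unfold Re, Im; ring.
Qed.

Lemma is_Cderive_scale (s : C) (t : R) : is_Cderive (fun u => s * u)%C t s.
Proof.
  eapply is_Cderive_eq.
  - apply (is_Cderive_mult (fun _ => s) RtoC); [apply is_Cderive_const | apply is_Cderive_RtoC].
  - ring.
Qed.

Lemma is_Cderive_Cexp_scale (s : C) (t : R) :
  is_Cderive (fun u => Cexp (s * u))%C t (s * Cexp (s * t))%C.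
Proof. apply is_Cderive_Cexp, is_Cderive_scale. Qed.

Lemma is_Cderive_Ccos_scale (z : C) (t : R) :
  is_Cderive (fun u => Ccos (z * u)) t (- (z * Csin (z * t)))%C.
Proof.
  apply is_Cderive_ext with (fun u : R => (Cexp (Ci * z * u) + Cexp (- (Ci * z) * u)) * / 2)%C.
  { intros u. unfold Ccos, Cdiv. f_equal. f_equal; f_equal; ring. }
  eapply is_Cderive_eq.
  - apply is_Cderive_mult; [apply is_Cderive_plus; apply is_Cderive_Cexp_scale
    | apply is_Cderive_const].
  - unfold Csin.
    replace (- (Ci * z) * t)%C with (- (Ci * (z * t)))%C by ring.
    replace (Ci * z * t)%C with (Ci * (z * t))%C by ring.
    (* This is where i^2 = -1 enters; what remains is an identity in [Ci] as an indeterminate. *)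
    replace (2 * Ci)%C with (- (2 / Ci))%C.
    + field. apply Ci_nz.
    + assert (H : (Ci * Ci = -1)%C) by (apply injective_projections; simpl; ring).
      replace (2 * Ci)%C with (2 * (Ci * Ci) / Ci)%C by (field; apply Ci_nz). rewrite H; field; apply Ci_nz.
Qed.

Lemma is_Cderive_Csin_scale (z : C) (t : R) :
  is_Cderive (fun u => Csin (z * u)) t (z * Ccos (z * t))%C.
Proof.
  apply is_Cderive_ext with (fun u : R => (Cexp (Ci * z * u) + - Cexp (- (Ci * z) * u)) * / (2 * Ci))%C.
  { intros u. unfold Csin, Cdiv, Cminus. f_equal. f_equal; [|f_equal]; f_equal; ring. }
  eapply is_Cderive_eq.
  - apply is_Cderive_mult; [apply is_Cderive_plus; [|apply is_Cderive_opp]; apply is_Cderive_Cexp_scale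
    | apply is_Cderive_const].
  - unfold Ccos.
    replace (- (Ci * z) * t)%C with (- (Ci * (z * t)))%C by ring.
    replace (Ci * z * t)%C with (Ci * (z * t))%C by ring.
    field. apply Ci_nz.
Qed.

(** * Growth of sine and cosine near 0, and the comparison of 1/sin^2 with 1/z^2 *)

(* Apply the real mean value theorem to [Re (conj (F 1 - F 0) * F t)]. *)
Lemma Cmod_increment_le (F F' : R -> C) (M : R) :
  (forall t, 0 <= t <= 1 -> is_Cderive F t (F' t)) ->
  (forall t, 0 <= t <= 1 -> Cmod (F' t) <= M) ->
  Cmod (F 1 - F 0) <= M.
Proof.
  intros HD HM. set (w := (F 1 - F 0)%C).
  set (phi := fun (v : C) => Re w * Re v + Im w * Im v).
  assert (Hphi : forall t, 0 <= t <= 1 -> is_derive (fun u => phi (F u)) t (phi (F' t))).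
  { intros t Ht. destruct (HD t Ht) as [H1 H2].
    apply (is_derive_plus (fun u => Re w * Re (F u)) (fun u => Im w * Im (F u)));
    [exact (is_derive_scal _ _ (Re w) _ H1) | exact (is_derive_scal _ _ (Im w) _ H2)]. }
  destruct (MVT_gen (fun u => phi (F u)) 0 1 (fun t => phi (F' t))) as [c [Hc E]].
  - rewrite Rmin_left, Rmax_right by lra. intros; apply Hphi; lra.
  - rewrite Rmin_left, Rmax_right by lra. intros x Hx. apply derivable_continuous_pt.
    eexists; apply is_derive_Reals, Hphi, Hx.
  - rewrite Rmin_left, Rmax_right in Hc by lra.
    assert (E1 : phi (F 1) - phi (F 0) = Cmod w ^ 2).
    { rewrite Cmod_sqr. unfold phi.
      change (Re w) with (Re (F 1) - Re (F 0)). change (Im w) with (Im (F 1) - Im (F 0)). ring. }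
    assert (E2 : phi (F' c) <= Cmod w * Cmod (F' c)).
    { rewrite <- (Cmod_conj w), <- Cmod_mult.
      apply Rle_trans with (Re (Cconj w * F' c)); [right; unfold phi; simpl; unfold Re, Im; ring|].
      eapply Rle_trans; [apply Rle_abs | apply re_le_Cmod]. }
    specialize (HM c Hc). assert (Hw := Cmod_ge_0 w).
    destruct (Req_dec (Cmod w) 0) as [E0|E0].
    + rewrite E0. eapply Rle_trans; [apply Cmod_ge_0 | apply HM].
    + nra.
Qed.

Lemma Cmod_Ccos_le (z : C) : Cmod (Ccos z) <= exp (Cmod z).
Proof.
  unfold Ccos. rewrite Cmod_div by (intros E; injection E; lra).
  rewrite Cmod_R, Rabs_pos_eq by lra.
  assert (H : forall w, Cmod w = Cmod z -> Cmod (Cexp w) <= exp (Cmod z)).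
  { intros w <-. rewrite Cmod_Cexp. apply exp_increasing_le.
    eapply Rle_trans; [apply Rle_abs | apply re_le_Cmod]. }
  assert (E : Cmod (Ci * z) = Cmod z).
  { rewrite Cmod_mult, Cmod_Ci. ring. }
  assert (H1 := H (Ci * z)%C E).
  assert (H2 := H (- (Ci * z))%C). rewrite Cmod_opp in H2. specialize (H2 E).
  assert (H3 := Cmod_triangle (Cexp (Ci * z)) (Cexp (- (Ci * z)))). lra.
Qed.

Lemma Cmod_scale_le (z : C) (t : R) : 0 <= t <= 1 -> Cmod (z * t) <= Cmod z.
Proof. intros Ht. rewrite Cmod_mult, Cmod_R, Rabs_pos_eq by lra. assert (H := Cmod_ge_0 z). nra. Qed.

Lemma Csin_0 : Csin 0 = 0.
Proof. rewrite Csin_RtoC, sin_0; reflexivity. Qed.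

Lemma Ccos_0 : Ccos 0 = 1.
Proof. rewrite Ccos_RtoC, cos_0; reflexivity. Qed.

(** First of three bounds, for sin z, cos z - 1 and sin z - z, each obtained from the preceding one
    by the mean value inequality along t -> z t, at the gain of one power of |z|. *)
Lemma Cmod_Csin_le (z : C) : Cmod (Csin z) <= Cmod z * exp (Cmod z).
Proof.
  replace (Csin z) with (Csin (z * 1) - Csin (z * 0))%C by (rewrite Cmult_1_r, Cmult_0_r, Csin_0; ring).
  apply (Cmod_increment_le (fun t => Csin (z * t)) (fun t => z * Ccos (z * t)))%C.
  - intros; apply is_Cderive_Csin_scale.
  - intros t Ht. rewrite Cmod_mult. apply Rmult_le_compat_l; [apply Cmod_ge_0|].
    eapply Rle_trans; [apply Cmod_Ccos_le|]. apply exp_increasing_le, Cmod_scale_le, Ht.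
Qed.

Lemma Cmod_Ccos_minus_1_le (z : C) : Cmod (Ccos z - 1) <= Cmod z ^ 2 * exp (Cmod z).
Proof.
  replace (Ccos z - 1)%C with (Ccos (z * 1) - Ccos (z * 0))%C by (rewrite Cmult_1_r, Cmult_0_r, Ccos_0; ring).
  apply (Cmod_increment_le (fun t => Ccos (z * t)) (fun t => - (z * Csin (z * t))))%C.
  - intros; apply is_Cderive_Ccos_scale.
  - intros t Ht. rewrite Cmod_opp, Cmod_mult. assert (H := Cmod_Csin_le (z * t)).
    assert (H1 := Cmod_scale_le z t Ht). assert (H2 := exp_increasing_le _ _ H1).
    assert (H3 := exp_pos (Cmod (z * t))). assert (H4 := Cmod_ge_0 (z * t)). assert (H5 := Cmod_ge_0 z).
    assert (Cmod (Csin (z * t)) <= Cmod z * exp (Cmod z)).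
    { eapply Rle_trans; [apply H|]. apply Rmult_le_compat; lra. }
    nra.
Qed.

Lemma Cmod_Csin_minus_id_le (z : C) : Cmod (Csin z - z) <= Cmod z ^ 3 * exp (Cmod z).
Proof.
  replace (Csin z - z)%C with ((Csin (z * 1) + - (z * 1)) - (Csin (z * 0) + - (z * 0)))%C
    by (rewrite Cmult_1_r, Cmult_0_r, Csin_0; ring).
  apply (Cmod_increment_le (fun t => Csin (z * t) + - (z * t)) (fun t => z * Ccos (z * t) + - z))%C.
  - intros; apply is_Cderive_plus; [apply is_Cderive_Csin_scale | apply is_Cderive_opp, is_Cderive_scale].
  - intros t Ht. replace (z * Ccos (z * t) + - z)%C with (z * (Ccos (z * t) - 1))%C by ring.
    rewrite Cmod_mult. assert (H := Cmod_Ccos_minus_1_le (z * t)).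
    assert (H1 := Cmod_scale_le z t Ht). assert (H2 := exp_increasing_le _ _ H1).
    assert (H3 := exp_pos (Cmod (z * t))). assert (H4 := Cmod_ge_0 (z * t)). assert (H5 := Cmod_ge_0 z).
    assert (Cmod (Ccos (z * t) - 1) <= Cmod z ^ 2 * exp (Cmod z)).
    { eapply Rle_trans; [apply H|]. apply Rmult_le_compat; try lra. apply pow2_ge_0. apply pow_incr; lra. }
    nra.
Qed.

(** The difference is -(sin z - z)(sin z + z) / (z^2 sin^2 z). The numerator is O(|z|^3) times
    O(|z|), and the denominator is at least |z|^4 / 49, so the powers of |z| cancel. *)
Lemma csc_sqr_minus_inv_sqr_bounded :
  exists K, 0 < K /\ forall z : C, z <> 0 -> Cmod z <= 5 * PI / 6 ->
    Cmod (1 / Csin z ^ 2 - 1 / z ^ 2) <= K.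
Proof.
  (* On the disc |z| <= 5 pi/6 <= 10/3 < 4, so [E] bounds exp |z|. *)
  set (E := exp 4). assert (HE : 0 < E) by apply exp_pos.
  exists (49 * E * (1 + E)). split; [nra|]. intros z Hz Hle.
  assert (Hpos := proj1 (Cmod_gt_0 z) Hz).
  assert (Hlow := Cmod_Csin_ge z Hle).
  assert (Hs : Csin z <> 0) by (apply Cmod_gt_0; lra).
  assert (HPI := PI_4).
  assert (HEz : exp (Cmod z) <= E) by (apply exp_increasing_le; lra).
  replace (1 / Csin z ^ 2 - 1 / z ^ 2)%C with (- ((Csin z - z) * (Csin z + z)) / (Csin z ^ 2 * z ^ 2))%C
    by (field; auto).
  rewrite Cmod_div, Cmod_opp, !Cmod_mult, !Cmod_pow by (apply Cmult_neq_0; apply Cpow_nz; assumption).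
  assert (H1 : Cmod (Csin z - z) <= Cmod z ^ 3 * E).
  { eapply Rle_trans; [apply Cmod_Csin_minus_id_le|].
    apply Rmult_le_compat_l; [apply pow_le; lra | exact HEz]. }
  assert (H2 : Cmod (Csin z + z) <= Cmod z * (1 + E)).
  { eapply Rle_trans; [apply Cmod_triangle|]. assert (H := Cmod_Csin_le z). nra. }
  assert (H3 : Cmod z ^ 2 / 49 <= Cmod (Csin z) ^ 2).
  { replace (Cmod z ^ 2 / 49) with ((Cmod z / 7) ^ 2) by field. apply pow_incr; lra. }
  assert (H0 : 0 < Cmod z ^ 2) by (apply pow_lt; lra).
  apply Rle_div_l; [nra|].
  apply Rle_trans with ((Cmod z ^ 3 * E) * (Cmod z * (1 + E))).
  - apply Rmult_le_compat; auto using Cmod_ge_0.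
  - replace (Cmod z ^ 3 * E * (Cmod z * (1 + E)))
      with (49 * E * (1 + E) * (Cmod z ^ 2 / 49 * Cmod z ^ 2)) by field.
    apply Rmult_le_compat_l; [nra|]. apply Rmult_le_compat_r; lra.
Qed.

(** * Finite complex sums *)

Fixpoint Csum (f : nat -> C) (n : nat) : C :=
  match n with
  | O => 0%C
  | S m => (Csum f m + f m)%C
  end.

Lemma Csum_ext (f g : nat -> C) (n : nat) :
  (forall k, (k < n)%nat -> f k = g k) -> Csum f n = Csum g n.
Proof.
  induction n as [|n IH]; intros H; simpl; [reflexivity|].
  rewrite IH, H by auto with arith. reflexivity.
Qed.

Lemma Csum_plus (f g : nat -> C) (n : nat) :
  Csum (fun k => f k + g k)%C n = (Csum f n + Csum g n)%C.
Proof. induction n as [|n IH]; simpl; [|rewrite IH]; ring. Qed.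

Lemma Csum_scal (c : C) (f : nat -> C) (n : nat) :
  Csum (fun k => c * f k)%C n = (c * Csum f n)%C.
Proof. induction n as [|n IH]; simpl; [|rewrite IH]; ring. Qed.

Lemma Csum_S_l (f : nat -> C) (n : nat) :
  Csum f (S n) = (f O + Csum (fun k => f (S k)) n)%C.
Proof. induction n as [|n IH]; simpl in *; [|rewrite IH]; ring. Qed.

Lemma Csum_rev (f : nat -> C) (n : nat) :
  Csum (fun k => f (n - S k)%nat) n = Csum f n.
Proof.
  induction n as [|n IH]; [reflexivity|].
  rewrite Csum_S_l. simpl. rewrite Nat.sub_0_r, IH. ring.
Qed.

Lemma Csum_cat (f : nat -> C) (n m : nat) :
  Csum f (n + m) = (Csum f n + Csum (fun k => f (n + k)%nat) m)%C.
Proof.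
  induction m as [|m IH]; [rewrite Nat.add_0_r; simpl; ring|].
  rewrite Nat.add_succ_r; simpl. rewrite IH; ring.
Qed.

Lemma Csum_even_odd (f : nat -> C) (n : nat) :
  Csum f (2 * n) = (Csum (fun k => f (2 * k)%nat) n + Csum (fun k => f (2 * k + 1)%nat) n)%C.
Proof.
  induction n as [|n IH]; [simpl; ring|].
  replace (2 * S n)%nat with (S (S (2 * n))) by lia.
  cbn [Csum]. rewrite IH. replace (2 * n + 1)%nat with (S (2 * n)) by lia. ring.
Qed.

Lemma Cmod_Csum_le (f : nat -> C) (K : R) (n : nat) :
  (forall k, (k < n)%nat -> Cmod (f k) <= K) -> Cmod (Csum f n) <= INR n * K.
Proof.
  induction n as [|n IH]; intros H; [simpl; rewrite Cmod_0; lra|].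
  rewrite S_INR. simpl. eapply Rle_trans; [apply Cmod_triangle|].
  assert (Cmod (Csum f n) <= INR n * K) by auto with arith.
  assert (Cmod (f n) <= K) by auto with arith. lra.
Qed.

(** * Partial fractions of 1/sin^2 by repeated halving *)

Lemma RtoC_neq_0 (x : R) : x <> 0 -> RtoC x <> 0.
Proof. intros H E. apply H, RtoC_inj, E. Qed.

Lemma Cdiv_neq_0 (z w : C) : z <> 0 -> w <> 0 -> (z / w)%C <> 0.
Proof.
  intros Hz Hw E. apply Hz. replace z with (z / w * w)%C by (field; exact Hw).
  rewrite E. ring.
Qed.

(** Since sin s = 2 sin(s/2) cos(s/2), writing the numerator 1 as sin^2 + cos^2 splits the fraction,
    and cos(s/2) = sin((s + pi)/2). The two nonvanishing claims allow the formula to be iterated. *)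
Lemma csc_sqr_split (s : C) : Csin s <> 0 ->
  Csin (s / 2) <> 0 /\ Csin ((s + PI) / 2) <> 0 /\
  (1 / Csin s ^ 2 = / 4 * (1 / Csin (s / 2) ^ 2 + 1 / Csin ((s + PI) / 2) ^ 2))%C.
Proof.
  intros Hs. replace ((s + PI) / 2)%C with (s / 2 + PI / 2)%C by field.
  rewrite Csin_plus_PI2.
  assert (E : Csin s = (2 * Csin (s / 2) * Ccos (s / 2))%C).
  { rewrite <- Csin_double. f_equal. field. }
  assert (H1 := Csin_sqr_plus_Ccos_sqr (s / 2)).
  assert (Hsn : Csin (s / 2) <> 0) by (intros H; apply Hs; rewrite E, H; ring).
  assert (Hcs : Ccos (s / 2) <> 0) by (intros H; apply Hs; rewrite E, H; ring).
  split; [exact Hsn|]. split; [exact Hcs|]. rewrite E.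
  replace (1 / (2 * Csin (s / 2) * Ccos (s / 2)) ^ 2)%C
    with ((Csin (s / 2) ^ 2 + Ccos (s / 2) ^ 2) / (2 * Csin (s / 2) * Ccos (s / 2)) ^ 2)%C
    by (rewrite H1; reflexivity).
  field. auto.
Qed.

(** Induction after one split of s: expanding at s/2 gives the even translates (s + 2k pi)/2^(n+1),
    expanding at (s + pi)/2 the odd ones. *)
Lemma csc_sqr_dyadic (n : nat) : forall s : C, Csin s <> 0 ->
  (1 / Csin s ^ 2 =
   (/ 4) ^ n * Csum (fun k => 1 / Csin ((s + INR k * PI) / 2 ^ n) ^ 2) (2 ^ n))%C.
Proof.
  induction n as [|n IH]; intros s Hs.
  - simpl. replace ((s + 0 * PI) / 1)%C with s by field. ring.
  - destruct (csc_sqr_split s Hs) as [H1 [H2 ->]].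
    rewrite (IH _ H1), (IH _ H2), <- Cmult_plus_distr_l, Cmult_assoc.
    rewrite Nat.pow_succ_r', Csum_even_odd.
    assert (Hp : (2 ^ n)%C <> 0) by (apply Cpow_nz, RtoC_neq_0; lra).
    change ((/ 4) ^ S n)%C with (/ 4 * (/ 4) ^ n)%C.
    change (2 ^ S n)%C with (2 * 2 ^ n)%C.
    f_equal. f_equal; apply Csum_ext; intros k _; do 3 f_equal.
    + rewrite mult_INR, RtoC_mult. replace (INR 2) with 2 by (simpl; ring). field. exact Hp.
    + rewrite plus_INR, mult_INR, RtoC_plus, RtoC_mult.
      replace (INR 2) with 2 by (simpl; ring). replace (INR 1) with 1 by (simpl; ring). field. exact Hp.
Qed.

(* The symmetric partial sums of [pi^2/sin^2 (pi (1+z)/2) = 4 sum_j 1/(z+j)^2], j odd. *)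
Lemma csc_sqr_partial_fractions (z : C) :
  Csin (PI / 2 * (1 + z)) <> 0 ->
  (forall k : nat, z + (2 * INR k + 1) <> 0 /\ z - (2 * INR k + 1) <> 0)%C ->
  exists (K : R) (n0 : nat), 0 < K /\ forall n, (n0 <= n)%nat ->
    Cmod (Csum (fun k => 1 / (z + (2 * INR k + 1)) ^ 2 + 1 / (z - (2 * INR k + 1)) ^ 2) (2 ^ n)
          - PI ^ 2 / 4 * (1 / Csin (PI / 2 * (1 + z)) ^ 2))%C <= K / 2 ^ n.
Proof.
  intros Hs Hz. destruct csc_sqr_minus_inv_sqr_bounded as [K [HK Hbound]].
  assert (HPI := PI_RGT_0). assert (HPI4 := PI_4).
  (* Chosen so that |z| < n0 + 1 <= 2^n whenever n >= n0. *)
  destruct (nfloor_ex (Cmod z) (Cmod_ge_0 z)) as [n0 Hn0].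
  exists (2 * K), n0. split; [lra|]. intros n Hn.
  set (s := (PI / 2 * (1 + z))%C) in *.
  set (d := fun w : C => (1 / Csin w ^ 2 - 1 / w ^ 2)%C) in *.
  (* With s = (pi/2)(1 + z), the angle (s + k pi)/2^(n+1) is exactly h (z + 2k + 1). *)
  set (h := (PI / 2 / (2 * 2 ^ n))%C).
  set (N := (2 ^ n)%nat).
  set (j := fun k : nat => (2 * INR k + 1)%C) in *.
  assert (HPIC : RtoC PI <> 0) by (apply RtoC_neq_0; lra).
  assert (Hpow : (2 ^ n)%C <> 0) by (apply Cpow_nz, RtoC_neq_0; lra).
  assert (HNR : INR N = 2 ^ n) by (unfold N; rewrite pow_INR; reflexivity).
  assert (HNC : RtoC (INR N) = (2 ^ n)%C) by (rewrite HNR; apply RtoC_pow).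
  assert (HNpos : 0 < 2 ^ n) by (apply pow_lt; lra).
  assert (Hbig : Cmod z <= 2 ^ n).
  { rewrite <- HNR. apply Rle_trans with (INR n0 + 1); [lra|]. rewrite <- S_INR.
    apply le_INR. assert (H := Nat.pow_gt_lin_r 2 n). unfold N. lia. }
  assert (Hh : h <> 0).
  { unfold h. apply Cdiv_neq_0; [apply Cdiv_neq_0 | apply Cmult_neq_0]; trivial; apply RtoC_neq_0; lra. }
  assert (Hh2 : (h ^ 2 = PI ^ 2 / 4 * (/ 4) ^ S n)%C).
  { rewrite Cpow_inv by (apply RtoC_neq_0; lra).
    replace (4 ^ S n)%C with ((2 * 2 ^ n) ^ 2)%C.
    - unfold h. field. exact Hpow.
    - change (2 * 2 ^ n)%C with (2 ^ S n)%C. rewrite <- !RtoC_pow, <- pow_mult, Nat.mul_comm, pow_mult.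
      do 2 f_equal. ring. }
  assert (Hcmod : Cmod (h ^ 2) <= / (2 ^ n) ^ 2).
  { unfold h. rewrite Cmod_pow, <- RtoC_pow, <- RtoC_mult, <- !RtoC_div by lra.
    rewrite Cmod_R, Rabs_pos_eq, <- pow_inv.
    - apply pow_incr. split.
      + apply Rlt_le, Rdiv_lt_0_compat; lra.
      + apply Rle_div_l; [lra|]. replace (/ 2 ^ n * (2 * 2 ^ n)) with 2 by (field; lra). lra.
    - apply Rlt_le, Rdiv_lt_0_compat; lra. }
  assert (Hsum : (PI ^ 2 / 4 * (1 / Csin s ^ 2) =
    Csum (fun k => h ^ 2 * (1 / Csin (h * (z + j k)) ^ 2 + 1 / Csin (h * (z - j k)) ^ 2)) N)%C).
  { rewrite (csc_sqr_dyadic (S n) s Hs), Cmult_assoc, <- Hh2, Csum_scal, Csum_plus.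
    f_equal. replace (2 ^ S n)%nat with (N + N)%nat by (unfold N; rewrite Nat.pow_succ_r'; lia).
    change (2 ^ S n)%C with (2 * 2 ^ n)%C.
    rewrite Csum_cat.
    (* The upper half of the angles is read backwards and shifted by -pi, which does not change
       sin^2. As 4 N h = pi, the index N + (N - 1 - k) becomes the angle h (z - (2k + 1)). *)
    rewrite <- (Csum_rev (fun k => 1 / Csin ((s + INR (N + k) * PI) / (2 * 2 ^ n)) ^ 2)%C).
    f_equal; apply Csum_ext; intros k Hk.
    - do 3 f_equal. unfold s, h, j. field. exact Hpow.
    - replace (h * (z - j k))%C
        with ((s + INR (N + (N - S k)) * PI) / (2 * 2 ^ n) - PI)%C.
      + rewrite Csin_minus_PI. f_equal. ring.
      + rewrite plus_INR, minus_INR, S_INR, RtoC_plus, RtoC_minus, RtoC_plus, HNC by lia.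
        unfold s, h, j. field. exact Hpow. }
  change (Cmod (Csum (fun k => 1 / (z + j k) ^ 2 + 1 / (z - j k) ^ 2) N
    - PI ^ 2 / 4 * (1 / Csin s ^ 2))%C <= 2 * K / 2 ^ n).
  rewrite Hsum.
  (* As 1/w^2 = h^2 / (h w)^2, exchanging 1/sin^2 for the inverse square costs h^2 [d] (h w) per
     term. *)
  assert (Hdiff : (Csum (fun k => 1 / (z + j k) ^ 2 + 1 / (z - j k) ^ 2) N =
    Csum (fun k => h ^ 2 * (1 / Csin (h * (z + j k)) ^ 2 + 1 / Csin (h * (z - j k)) ^ 2)) N
    + - h ^ 2 * Csum (fun k => d (h * (z + j k)) + d (h * (z - j k))) N)%C).
  { rewrite <- Csum_scal, <- Csum_plus. apply Csum_ext. intros k _. unfold d.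
    destruct (Hz k) as [H1 H2].
    assert (E : forall w : C, w <> 0 -> (1 / w ^ 2 = h ^ 2 * (1 / (h * w) ^ 2))%C).
    { intros w Hw. field. auto. }
    rewrite (E (z + j k)%C H1), (E (z - j k)%C H2). ring. }
  rewrite Hdiff.
  match goal with |- Cmod (?a + ?b - ?a) <= _ => replace (a + b - a)%C with b by ring end.
  rewrite Cmod_mult, Cmod_opp.
  (* There are 2N bounded errors against a factor h^2 <= 1/N^2, hence a total of at most 2K/N. *)
  assert (Hd : Cmod (Csum (fun k => d (h * (z + j k)) + d (h * (z - j k)))%C N) <= INR N * (2 * K)).
  { apply Cmod_Csum_le. intros k Hk.
    assert (Hj : Cmod (j k) <= 2 * 2 ^ n).
    { unfold j. rewrite <- RtoC_mult, <- RtoC_plus, Cmod_R, Rabs_pos_eq.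
      - rewrite <- HNR. assert (H := le_INR _ _ Hk). rewrite S_INR in H. lra.
      - assert (H := pos_INR k). lra. }
    (* Here |h w| <= pi/(4 * 2^n) * (2^n + 2 * 2^n) = 3 pi/4, inside the disc where [d] is
       bounded. *)
    assert (Hw : forall w : C, w <> 0 -> Cmod w <= Cmod z + Cmod (j k) -> Cmod (d (h * w)%C) <= K).
    { intros w Hw0 Hw. apply (Hbound (h * w)%C); [apply Cmult_neq_0; [exact Hh | exact Hw0]|].
      rewrite Cmod_mult. unfold h.
      rewrite <- RtoC_pow, <- RtoC_mult, <- !RtoC_div, Cmod_R, Rabs_pos_eq by
        (try (apply Rlt_le, Rdiv_lt_0_compat); lra).
      apply Rle_trans with (PI / 2 / (2 * 2 ^ n) * (3 * 2 ^ n)).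
      - apply Rmult_le_compat_l; [apply Rlt_le, Rdiv_lt_0_compat|]; lra.
      - replace (PI / 2 / (2 * 2 ^ n) * (3 * 2 ^ n)) with (3 * PI / 4) by (field; lra). lra. }
    destruct (Hz k) as [H1 H2].
    eapply Rle_trans; [apply Cmod_triangle|]. replace (2 * K) with (K + K) by ring.
    apply Rplus_le_compat; apply Hw; trivial; [apply Cmod_triangle|].
    unfold Cminus. eapply Rle_trans; [apply Cmod_triangle|]. rewrite Cmod_opp. lra. }
  apply Rle_trans with (/ (2 ^ n) ^ 2 * (INR N * (2 * K))).
  - apply Rmult_le_compat; auto using Cmod_ge_0.
  - rewrite HNR. right. field. lra.
Qed.

(** * Integrals and limits of complex functions of a real variable *)

Lemma is_Cderive_Csum (F F' : nat -> R -> C) (t : R) (n : nat) :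
  (forall k, is_Cderive (F k) t (F' k t)) ->
  is_Cderive (fun u => Csum (fun k => F k u) n) t (Csum (fun k => F' k t) n).
Proof.
  intros H. induction n as [|n IH]; simpl; [apply is_Cderive_const|].
  apply is_Cderive_plus; [exact IH | apply H].
Qed.

Lemma is_Cderive_continuous (F : R -> C) (t : R) (l : C) :
  is_Cderive F t l ->
  continuous (fun u => Re (F u)) t /\ continuous (fun u => Im (F u)) t.
Proof.
  intros [H1 H2]. split.
  - apply (ex_derive_continuous (V := R_NormedModule)). eexists; exact H1.
  - apply (ex_derive_continuous (V := R_NormedModule)). eexists; exact H2.
Qed.

Lemma ex_RInt_Cderive (F : R -> C) (p q : R) : p <= q ->
  (forall x, p <= x <= q -> exists l, is_Cderive F x l) ->
  ex_RInt (V := C_R_NormedModule) F p q.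
Proof.
  intros Hpq H.
  assert (H1 : ex_RInt (fun u => Re (F u)) p q).
  { apply (ex_RInt_continuous (V := R_CompleteNormedModule)).
    rewrite Rmin_left, Rmax_right by lra. intros x Hx. destruct (H x Hx) as [l Hl].
    apply (is_Cderive_continuous _ _ _ Hl). }
  assert (H2 : ex_RInt (fun u => Im (F u)) p q).
  { apply (ex_RInt_continuous (V := R_CompleteNormedModule)).
    rewrite Rmin_left, Rmax_right by lra. intros x Hx. destruct (H x Hx) as [l Hl].
    apply (is_Cderive_continuous _ _ _ Hl). }
  destruct H1 as [u Hu], H2 as [v Hv]. exists (u, v).
  apply (is_RInt_fct_extend_pair (U := R_NormedModule) (V := R_NormedModule) F p q u v Hu Hv).
Qed.

(** The fundamental theorem of calculus on each component; the differentiability of [F'] supplies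
    the continuity of the integrand. *)
Lemma is_RInt_Cderive (F F' : R -> C) (p q : R) : p <= q ->
  (forall x, p <= x <= q -> is_Cderive F x (F' x)) ->
  (forall x, p <= x <= q -> exists l, is_Cderive F' x l) ->
  is_RInt (V := C_R_NormedModule) F' p q (F q - F p)%C.
Proof.
  intros Hpq HF HF'.
  apply (is_RInt_fct_extend_pair (U := R_NormedModule) (V := R_NormedModule) F' p q).
  - apply (is_RInt_derive (V := R_CompleteNormedModule) (fun u => Re (F u)) (fun u => Re (F' u)));
      rewrite Rmin_left, Rmax_right by lra; intros x Hx.
    + apply HF, Hx.
    + destruct (HF' x Hx) as [l Hl]. apply (is_Cderive_continuous _ _ _ Hl).
  - apply (is_RInt_derive (V := R_CompleteNormedModule) (fun u => Im (F u)) (fun u => Im (F' u)));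
      rewrite Rmin_left, Rmax_right by lra; intros x Hx.
    + apply HF, Hx.
    + destruct (HF' x Hx) as [l Hl]. apply (is_Cderive_continuous _ _ _ Hl).
Qed.

(** An epsilon form in [Cmod], common to both end points, so that limits feed directly into triangle
    inequalities. *)
Definition Clim (Fl : (R -> Prop) -> Prop) (g : R -> C) (l : C) : Prop :=
  forall eps, 0 < eps -> Fl (fun x => Cmod (g x - l) < eps).

Lemma Clim_plus (Fl : (R -> Prop) -> Prop) {FF : Filter Fl} (g h : R -> C) (l m : C) :
  Clim Fl g l -> Clim Fl h m -> Clim Fl (fun x => g x + h x)%C (l + m)%C.
Proof.
  intros Hg Hh eps He.
  assert (He2 : 0 < eps / 2) by lra.
  refine (filter_imp _ _ _ (filter_and _ _ (Hg _ He2) (Hh _ He2))). intros x [H1 H2].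
  replace (g x + h x - (l + m))%C with ((g x - l) + (h x - m))%C by ring.
  eapply Rle_lt_trans; [apply Cmod_triangle | lra].
Qed.

Lemma Clim_Csum (Fl : (R -> Prop) -> Prop) {FF : Filter Fl}
    (g : nat -> R -> C) (l : nat -> C) (n : nat) :
  (forall k, Clim Fl (g k) (l k)) -> Clim Fl (fun x => Csum (fun k => g k x) n) (Csum l n).
Proof.
  intros H. induction n as [|n IH]; simpl.
  - intros eps He. apply filter_forall. intros _.
    replace (0 - 0)%C with (RtoC 0) by ring. rewrite Cmod_0. exact He.
  - apply Clim_plus; [exact FF | exact IH | apply H].
Qed.

Lemma is_Cderive_Clim_at_right (F : R -> C) (t : R) (l : C) :
  is_Cderive F t l -> Clim (at_right t) F (F t).
Proof.
  intros H eps He. destruct (is_Cderive_continuous _ _ _ H) as [H1 H2].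
  apply filter_le_within.
  assert (He2 : 0 < eps / 2) by lra.
  assert (B1 := proj1 (filterlim_locally _ _) H1 (mkposreal _ He2)).
  assert (B2 := proj1 (filterlim_locally _ _) H2 (mkposreal _ He2)).
  refine (filter_imp _ _ _ (filter_and _ _ B1 B2)). intros x [E1 E2].
  assert (Habs : Cmod (F x - F t) <= Rabs (Re (F x) - Re (F t)) + Rabs (Im (F x) - Im (F t))).
  { replace (F x - F t)%C with (RtoC (Re (F x) - Re (F t)) + Ci * RtoC (Im (F x) - Im (F t)))%C
      by (apply injective_projections; simpl; unfold Re, Im; ring).
    eapply Rle_trans; [apply Cmod_triangle|]. rewrite Cmod_mult, Cmod_Ci, !Cmod_R. lra. }
  change (Rabs (Re (F x) - Re (F t)) < eps / 2) in E1.
  change (Rabs (Im (F x) - Im (F t)) < eps / 2) in E2. lra.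
Qed.

(** * The integral of x exp(-s x) *)

(** The antiderivative of x exp(-s x) given by integration by parts, with the constant for which it
    tends to 0 at infinity when Re s > 0. *)
Definition xexp_prim (s : C) (x : R) : C := (- (x / s + 1 / s ^ 2) * Cexp (- s * x))%C.

Lemma is_Cderive_xexp_prim (s : C) (x : R) : s <> 0 ->
  is_Cderive (xexp_prim s) x (x * Cexp (- s * x))%C.
Proof.
  intros Hs. eapply is_Cderive_eq.
  - apply is_Cderive_mult; [|apply is_Cderive_Cexp_scale].
    apply is_Cderive_opp, is_Cderive_plus; [|apply is_Cderive_const].
    apply is_Cderive_mult; [apply is_Cderive_RtoC | apply is_Cderive_const].
  - cbv beta. field. exact Hs.
Qed.

Lemma xexp_prim_0 (s : C) : xexp_prim s 0 = (- (1 / s ^ 2))%C.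
Proof. unfold xexp_prim. rewrite Cmult_0_r, Cexp_0. unfold Cdiv. ring. Qed.

Lemma xexp_prim_lim_infty (s : C) : 0 < Re s -> Clim (Rbar_locally p_infty) (xexp_prim s) 0.
Proof.
  intros Hs eps He. assert (Hm := re_le_Cmod s). rewrite Rabs_pos_eq in Hm by lra.
  set (r := Re s) in *.
  (* For x > 1 the prefactor is at most (1/r + 1/r^2) x, and exp(-r x) <= 4/(r x)^2 because exp(y/2)
     >= y/2; the product is K/x. *)
  set (K := 4 * (1 / r + 1 / r ^ 2) / r ^ 2).
  assert (Hr2 : 0 < r ^ 2) by (apply pow_lt; exact Hs).
  assert (Hr1 : 0 < 1 / r) by (apply Rdiv_lt_0_compat; lra).
  assert (Hr3 : 0 < 1 / r ^ 2) by (apply Rdiv_lt_0_compat; lra).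
  assert (HK : 0 < K) by (apply Rdiv_lt_0_compat; lra).
  assert (Hs0 : s <> 0) by (apply Cmod_gt_0; lra).
  exists (Rmax 1 (K / eps)). intros x Hx.
  assert (Hx1 : 1 < x) by (eapply Rle_lt_trans; [apply Rmax_l | exact Hx]).
  assert (Hx2 : K / eps < x) by (eapply Rle_lt_trans; [apply Rmax_r | exact Hx]).
  apply Rlt_div_l in Hx2; [|exact He].
  replace (xexp_prim s x - 0)%C with (xexp_prim s x) by ring.
  unfold xexp_prim. rewrite Cmod_mult, Cmod_opp, Cmod_Cexp.
  replace (Re (- s * x)) with (- (r * x)) by (unfold r; simpl; unfold Re; ring).
  assert (B1 : Cmod (x / s + 1 / s ^ 2) <= (1 / r + 1 / r ^ 2) * x).
  { eapply Rle_trans; [apply Cmod_triangle|].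
    rewrite !Cmod_div, Cmod_pow, !Cmod_R, !Rabs_pos_eq by (try lra; try apply Cpow_nz; assumption).
    assert (x / Cmod s <= 1 / r * x).
    { unfold Rdiv. rewrite Rmult_1_l, Rmult_comm. apply Rmult_le_compat_r; [lra|].
      apply Rinv_le_contravar; lra. }
    assert (1 / Cmod s ^ 2 <= 1 / r ^ 2).
    { unfold Rdiv. rewrite !Rmult_1_l. apply Rinv_le_contravar; [exact Hr2 | apply pow_incr; lra]. }
    nra. }
  assert (B2 : exp (- (r * x)) <= 4 / (r * x) ^ 2).
  { rewrite exp_Ropp. replace (4 / (r * x) ^ 2) with (/ (r * x / 2) ^ 2) by (field; nra).
    apply Rinv_le_contravar; [apply pow_lt; nra|].
    replace (exp (r * x)) with (exp (r * x / 2) ^ 2).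
    - apply pow_incr. assert (H := exp_ineq1_le (r * x / 2)). nra.
    - simpl. rewrite Rmult_1_r, <- exp_plus. f_equal. field. }
  apply Rle_lt_trans with ((1 / r + 1 / r ^ 2) * x * (4 / (r * x) ^ 2)).
  - apply Rmult_le_compat; auto using Cmod_ge_0. apply Rlt_le, exp_pos.
  - replace ((1 / r + 1 / r ^ 2) * x * (4 / (r * x) ^ 2)) with (K / x) by (unfold K; field; lra).
    apply Rlt_div_l; lra.
Qed.

(** * The integrand: bounds, finite expansion and approximate integral *)

Lemma Cmod_Csinh_ge (w : C) : (exp (Re w) - exp (- Re w)) / 2 <= Cmod (Csinh w).
Proof.
  unfold Csinh. rewrite Cmod_div by (apply RtoC_neq_0; lra). rewrite Cmod_R, Rabs_pos_eq by lra.
  assert (H := Cmod_triangle (Cexp w - Cexp (- w)) (Cexp (- w))).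
  replace (Cexp w - Cexp (- w) + Cexp (- w))%C with (Cexp w) in H by ring.
  rewrite !Cmod_Cexp in H. change (Re (- w)) with (- Re w) in H. lra.
Qed.

Lemma Cmod_Ccosh_le (w : C) : Cmod (Ccosh w) <= exp (Rabs (Re w)).
Proof.
  unfold Ccosh. rewrite Cmod_div by (apply RtoC_neq_0; lra). rewrite Cmod_R, Rabs_pos_eq by lra.
  assert (H := Cmod_triangle (Cexp w) (Cexp (- w))).
  rewrite !Cmod_Cexp in H. change (Re (- w)) with (- Re w) in H.
  assert (H1 := exp_increasing_le _ _ (Rle_abs (Re w))).
  assert (H2 := exp_increasing_le _ _ (Rle_abs (- Re w))). rewrite Rabs_Ropp in H2. lra.
Qed.

Definition integrand (a b : C) (x : R) : C := (Ccosh (b * x) / Csinh (a * x) * x)%C.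

Lemma Re_scale (a : C) (x : R) : Re (a * x) = Re a * x.
Proof. simpl; unfold Re; ring. Qed.

Lemma Csinh_neq_0 (w : C) : 0 < Re w -> Csinh w <> 0.
Proof.
  intros Hw. apply Cmod_gt_0. eapply Rlt_le_trans; [|apply Cmod_Csinh_ge].
  assert (H := exp_increasing (- Re w) (Re w) ltac:(lra)). lra.
Qed.

(** One bound serves both near 0 and at infinity. With r = Re a, 2 r x <= exp(2 r x) - 1 gives r x
    <= exp(r x) |sinh(a x)|, which absorbs the singularity at 0; the growth at infinity is later
    cancelled by a factor of the geometric remainder. *)
Lemma Cmod_integrand_le (a b : C) (x : R) : Rabs (Re b) < Re a -> 0 < x ->
  Cmod (integrand a b x) <= exp (2 * Re a * x) / Re a.
Proof.
  intros Hab Hx. assert (Hb := Rabs_pos (Re b)). set (r := Re a) in *.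
  assert (Hrx : 0 < r * x) by nra.
  unfold integrand. rewrite Cmod_mult, Cmod_div by (apply Csinh_neq_0; rewrite Re_scale; exact Hrx).
  rewrite Cmod_R, Rabs_pos_eq by lra.
  assert (Hc : Cmod (Ccosh (b * x)) <= exp (r * x)).
  { eapply Rle_trans; [apply Cmod_Ccosh_le|]. apply exp_increasing_le.
    rewrite Re_scale, Rabs_mult, (Rabs_pos_eq x) by lra. nra. }
  assert (Hs := Cmod_Csinh_ge (a * x)). rewrite Re_scale in Hs. fold r in Hs.
  assert (E := exp_pos (r * x)).
  assert (E2 : exp (2 * r * x) = exp (r * x) * exp (r * x)) by (rewrite <- exp_plus; f_equal; ring).
  assert (E1 := exp_ineq1_le (2 * r * x)).
  rewrite exp_Ropp in Hs. rewrite E2 in *. set (e := exp (r * x)) in *.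
  set (S := Cmod (Csinh (a * x))) in *. set (Co := Cmod (Ccosh (b * x))) in *.
  assert (Hs' : r * x <= e * S).
  { apply Rmult_le_compat_l with (r := e) in Hs; [|lra].
    replace (e * ((e - / e) / 2)) with ((e * e - 1) / 2) in Hs by (field; lra). lra. }
  assert (HS : 0 < S) by nra.
  apply Rle_trans with (e / S * x).
  - apply Rmult_le_compat_r; [lra|]. apply Rmult_le_compat_r; [|exact Hc].
    apply Rlt_le, Rinv_0_lt_compat, HS.
  - apply Rmult_le_reg_r with (S * r); [nra|].
    replace (e / S * x * (S * r)) with (e * (r * x)) by (field; lra).
    replace (e * e / r * (S * r)) with (e * (e * S)) by (field; lra).
    apply Rmult_le_compat_l; lra.
Qed.

(** Each step is the exact identity cosh(bx)/sinh(ax) (1 - exp(-2ax)) = exp(-(a+b)x) + exp(-(a-b)x),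
    multiplied by x exp(-2nax); no infinite series is exchanged with the integral. *)
Lemma integrand_expansion (a b : C) (x : R) (n : nat) : Csinh (a * x) <> 0 ->
  integrand a b x =
  (Csum (fun k => x * Cexp (- ((2 * INR k + 1) * a + b) * x)
                + x * Cexp (- ((2 * INR k + 1) * a - b) * x)) n
   + integrand a b x * Cexp (- (2 * INR n * a) * x))%C.
Proof.
  intros Hs. induction n as [|n IH].
  - simpl. replace (- (2 * 0 * a) * x)%C with (RtoC 0) by ring. rewrite Cexp_0. ring.
  - rewrite IH at 1. cbn [Csum]. rewrite <- Cplus_assoc. f_equal.
    rewrite S_INR, RtoC_plus.
    replace (- ((2 * INR n + 1) * a + b) * x)%C
      with (- (2 * INR n * a) * x + (- (a * x) + - (b * x)))%C by ring.
    replace (- ((2 * INR n + 1) * a - b) * x)%C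
      with (- (2 * INR n * a) * x + (- (a * x) + (b * x)))%C by ring.
    replace (- (2 * (INR n + 1) * a) * x)%C
      with (- (2 * INR n * a) * x + (- (a * x) + - (a * x)))%C by ring.
    rewrite !Cexp_plus. unfold integrand, Ccosh.
    unfold Csinh in *. rewrite !Cexp_opp in *.
    assert (Ha := Cexp_neq_0 (a * x)). assert (Hb := Cexp_neq_0 (b * x)).
    set (A := Cexp (a * x)) in *. set (B := Cexp (b * x)) in *.
    field. repeat split; trivial. intros E. apply Hs.
    replace (A - / A)%C with ((A * A - 1) / A)%C by (field; trivial). rewrite E. field. trivial.
Qed.

Lemma ex_is_Cderive_integrand (a b : C) (x : R) : Csinh (a * x) <> 0 ->
  exists l, is_Cderive (integrand a b) x l.
Proof.
  intros Hs. eexists. unfold integrand, Cdiv.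
  assert (D : forall c : C, is_Cderive (fun u => Cexp (- (c * u))) x (- c * Cexp (- (c * x)))%C).
  { intros c. apply is_Cderive_Cexp, is_Cderive_opp, is_Cderive_scale. }
  apply is_Cderive_mult; [apply is_Cderive_mult | apply is_Cderive_RtoC].
  - unfold Ccosh, Cdiv. apply is_Cderive_mult; [|apply is_Cderive_const].
    apply is_Cderive_plus; [apply is_Cderive_Cexp_scale | apply D].
  - apply is_Cderive_inv; [|exact Hs].
    unfold Csinh, Cdiv. apply is_Cderive_mult; [|apply is_Cderive_const].
    apply is_Cderive_plus; [apply is_Cderive_Cexp_scale | apply is_Cderive_opp, D].
Qed.

Definition expansion_prim (a b : C) (n : nat) (x : R) : C :=
  Csum (fun k => xexp_prim ((2 * INR k + 1) * a + b) x + xexp_prim ((2 * INR k + 1) * a - b) x)%C n.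

Lemma Re_odd_mult_pos (a b : C) (k : nat) : Rabs (Re b) < Re a ->
  0 < Re ((2 * INR k + 1) * a + b)%C /\ 0 < Re ((2 * INR k + 1) * a - b)%C.
Proof.
  intros H. apply Rabs_def2 in H. assert (Hk := pos_INR k). destruct a, b. simpl in *.
  split; nra.
Qed.

Lemma Re_pos_neq_0 (z : C) : 0 < Re z -> z <> 0.
Proof. intros H ->. simpl in H. lra. Qed.

(** Of the m + 1 factors exp(-2ax) in the remainder, one cancels the growth of the integrand bound
    and the other m leave exp(-2 m Re a x)/Re a, whose integral is at most the stated error whatever
    p and q are. *)
Lemma integrand_RInt_approx (a b : C) (m : nat) (p q : R) :
  Rabs (Re b) < Re a -> (0 < m)%nat -> 0 < p <= q ->
  exists y : C, is_RInt (V := C_R_NormedModule) (integrand a b) p q y /\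
    Cmod (y - (expansion_prim a b (S m) q - expansion_prim a b (S m) p)) <=
    / (2 * Re a ^ 2 * INR m).
Proof.
  intros Hab Hm [Hp Hpq]. assert (Hb := Rabs_pos (Re b)).
  assert (Hm1 : 1 <= INR m) by (apply (le_INR 1); lia).
  assert (Hsinh : forall x, p <= x -> Csinh (a * x) <> 0).
  { intros x Hx. apply Csinh_neq_0. rewrite Re_scale. nra. }
  assert (Hex := fun x (H : p <= x) => ex_is_Cderive_integrand a b x (Hsinh x H)).
  destruct (ex_RInt_Cderive (integrand a b) p q Hpq) as [y Hy].
  { intros x Hx. apply Hex; lra. }
  exists y. split; [exact Hy|].
  set (rem := fun x => (integrand a b x * Cexp (- (2 * INR (S m) * a) * x))%C).
  (* This is the finite sum of exponentials, written so that its distance to the integrand is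
     visibly [rem] and its differentiability comes from that of the integrand. *)
  set (F' := fun x => (integrand a b x + - rem x)%C).
  assert (HF' : is_RInt (V := C_R_NormedModule) F' p q
                  (expansion_prim a b (S m) q - expansion_prim a b (S m) p)%C).
  { apply is_RInt_Cderive; [exact Hpq| |].
    - intros x Hx. eapply is_Cderive_eq.
      + apply (is_Cderive_Csum
          (fun k x => xexp_prim ((2 * INR k + 1) * a + b) x + xexp_prim ((2 * INR k + 1) * a - b) x)%C
          (fun k x => x * Cexp (- ((2 * INR k + 1) * a + b) * x)
                + x * Cexp (- ((2 * INR k + 1) * a - b) * x))%C).
        intros k. destruct (Re_odd_mult_pos a b k Hab) as [H1 H2].
        apply is_Cderive_plus; apply is_Cderive_xexp_prim, Re_pos_neq_0; assumption.
      + unfold F', rem. rewrite (integrand_expansion a b x (S m)) at 1 by (apply Hsinh; lra). ring.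
    - intros x Hx. destruct (Hex x ltac:(lra)) as [l Hl]. eexists.
      apply is_Cderive_plus; [exact Hl|]. apply is_Cderive_opp, is_Cderive_mult;
      [exact Hl | apply is_Cderive_Cexp_scale]. }
  set (D := 2 * Re a * INR m).
  assert (HD : 0 < D) by (unfold D; nra).
  assert (HE : is_RInt (fun x => / Re a * exp (- D * x)) p q
                 (/ Re a * (- exp (- D * q) / D) - / Re a * (- exp (- D * p) / D))).
  { apply (is_RInt_derive (V := R_CompleteNormedModule) (fun x => / Re a * (- exp (- D * x) / D))).
    - intros x _. auto_derive; [trivial|]. field. lra.
    - intros x _. apply (ex_derive_continuous (V := R_NormedModule)). auto_derive. trivial. }
  assert (Hdiff := is_RInt_minus _ _ _ _ _ _ Hy HF').
  rewrite Cmod_norm.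
  eapply Rle_trans; [apply (norm_RInt_le _ _ p q _ _ Hpq) with (2 := Hdiff) (3 := HE)|].
  - intros x Hx. rewrite <- Cmod_norm. change (Cmod (integrand a b x - F' x) <= / Re a * exp (- D * x)).
    unfold F'. replace (integrand a b x - (integrand a b x + - rem x))%C with (rem x) by ring.
    unfold rem. rewrite Cmod_mult, Cmod_Cexp.
    replace (Re (- (2 * INR (S m) * a) * x)) with (- D * x - 2 * Re a * x)
      by (rewrite S_INR; unfold D; simpl; unfold Re; ring).
    assert (H := Cmod_integrand_le a b x Hab ltac:(lra)).
    apply Rle_trans with (exp (2 * Re a * x) / Re a * exp (- D * x - 2 * Re a * x)).
    + apply Rmult_le_compat_r; [apply Rlt_le, exp_pos | exact H].
    + right. unfold Rdiv. rewrite (Rmult_comm (exp _)), Rmult_assoc, <- exp_plus.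
      do 2 f_equal. ring.
  - assert (H1 := exp_pos (- D * q)).
    assert (H2 : exp (- D * p) <= 1) by (rewrite <- exp_0; apply exp_increasing_le; nra).
    replace (/ (2 * Re a ^ 2 * INR m)) with (/ Re a * (1 / D)) by (unfold D; field; lra).
    replace (/ Re a * (- exp (- D * q) / D) - / Re a * (- exp (- D * p) / D))
      with (/ Re a * ((exp (- D * p) - exp (- D * q)) / D)) by (field; lra).
    apply Rmult_le_compat_l; [apply Rlt_le, Rinv_0_lt_compat; lra|].
    apply Rmult_le_compat_r; [apply Rlt_le, Rinv_0_lt_compat; lra|]. lra.
Qed.

(** * Boundary values and summation of the series *)

Lemma expansion_prim_lim_infty (a b : C) (n : nat) : Rabs (Re b) < Re a ->
  Clim (Rbar_locally p_infty) (expansion_prim a b n) 0.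
Proof.
  intros Hab. replace (RtoC 0) with (Csum (fun _ => 0 + 0)%C n).
  - apply (Clim_Csum _ (fun k x => _ + _)%C). intros k.
    destruct (Re_odd_mult_pos a b k Hab) as [H1 H2].
    apply Clim_plus; [typeclasses eauto | |]; apply xexp_prim_lim_infty; assumption.
  - induction n as [|n IH]; simpl; [reflexivity|]. rewrite IH. ring.
Qed.

Lemma expansion_prim_lim_0 (a b : C) (n : nat) : Rabs (Re b) < Re a ->
  Clim (at_right 0) (expansion_prim a b n)
    (Csum (fun k => - (1 / ((2 * INR k + 1) * a + b) ^ 2)
                    + - (1 / ((2 * INR k + 1) * a - b) ^ 2)) n)%C.
Proof.
  intros Hab. apply (Clim_Csum _ (fun k x => _ + _)%C). intros k.
  destruct (Re_odd_mult_pos a b k Hab) as [H1 H2].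
  rewrite <- !xexp_prim_0.
  apply Clim_plus; [typeclasses eauto | |];
  eapply is_Cderive_Clim_at_right, is_Cderive_xexp_prim, Re_pos_neq_0; assumption.
Qed.

(** A zero would give b = (2k - 1) a for an integer k, and |2k - 1| >= 1 contradicts |Re b| < Re
    a. *)
Lemma Csin_half_PI_neq_0 (a b : C) : Rabs (Re b) < Re a ->
  Csin (PI / 2 * (1 + b / a)) <> 0.
Proof.
  intros Hab H. destruct (Csin_eq_0 _ H) as [k Hk].
  assert (Hb := Rabs_pos (Re b)). assert (HPI := PI_RGT_0).
  assert (Ha : a <> 0) by (apply Re_pos_neq_0; lra).
  assert (HPIC : RtoC PI <> 0) by (apply RtoC_neq_0; lra).
  assert (E : b = ((2 * IZR k - 1) * a)%C).
  { replace b with (PI / 2 * (1 + b / a) * (2 * a / PI) - a)%C by (field; auto).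
    rewrite Hk. field. auto. }
  assert (ER : Re b = (2 * IZR k - 1) * Re a).
  { rewrite E. destruct a; simpl. ring. }
  rewrite ER in Hab. apply Rabs_def2 in Hab.
  destruct (Z.le_gt_cases k 0) as [Hle|Hgt].
  - apply IZR_le in Hle. nra.
  - assert (H1 : (1 <= k)%Z) by lia. apply IZR_le in H1. nra.
Qed.

(** By homogeneity this is the case z = b/a multiplied by 1/a^2: (2k+1) a - b is -a (z - (2k+1)),
    and the sign disappears in the square. *)
Lemma sum_inv_sqr_odd_multiples_lim (a b : C) (eps : R) : Rabs (Re b) < Re a -> 0 < eps ->
  exists n0 : nat, forall n, (n0 <= n)%nat ->
    Cmod (Csum (fun k => 1 / ((2 * INR k + 1) * a + b) ^ 2
                       + 1 / ((2 * INR k + 1) * a - b) ^ 2) (2 ^ n)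
          - PI ^ 2 / (4 * a ^ 2) * (1 / Csin (PI / 2 * (1 + b / a)) ^ 2))%C < eps.
Proof.
  intros Hab He. assert (Hb := Rabs_pos (Re b)).
  assert (Ha : a <> 0) by (apply Re_pos_neq_0; lra).
  assert (Hsin := Csin_half_PI_neq_0 a b Hab).
  assert (Hk : forall k, (b / a + (2 * INR k + 1) <> 0 /\ b / a - (2 * INR k + 1) <> 0)%C).
  { intros k. destruct (Re_odd_mult_pos a b k Hab) as [H1 H2].
    apply Re_pos_neq_0 in H1. apply Re_pos_neq_0 in H2. split; intros E.
    - apply H1. replace ((2 * INR k + 1) * a + b)%C with (a * (b / a + (2 * INR k + 1)))%C
        by (field; exact Ha).
      rewrite E. ring.
    - apply H2. replace ((2 * INR k + 1) * a - b)%C with (- a * (b / a - (2 * INR k + 1)))%C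
        by (field; exact Ha).
      rewrite E. ring. }
  destruct (csc_sqr_partial_fractions (b / a) Hsin Hk) as [K [n0 [HK H]]].
  set (c := Cmod (1 / a ^ 2)).
  assert (Hc : 0 <= c) by apply Cmod_ge_0.
  (* Then c K / eps < M + 1 <= 2^n for n >= M, which puts the error c K / 2^n below eps. *)
  destruct (nfloor_ex (c * K / eps)) as [M HM].
  { apply Rmult_le_pos; [nra | apply Rlt_le, Rinv_0_lt_compat, He]. }
  exists (max n0 M). intros n Hn. specialize (H n ltac:(lia)).
  assert (H2n : INR M + 1 <= 2 ^ n).
  { change 2 with (INR 2). rewrite <- pow_INR, <- S_INR. apply le_INR.
    assert (H0 := Nat.pow_gt_lin_r 2 n). lia. }
  replace (Csum _ _ - _)%C
    with (1 / a ^ 2 * (Csum (fun k => 1 / (b / a + (2 * INR k + 1)) ^ 2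
                                  + 1 / (b / a - (2 * INR k + 1)) ^ 2) (2 ^ n)
          - PI ^ 2 / 4 * (1 / Csin (PI / 2 * (1 + b / a)) ^ 2)))%C.
  - rewrite Cmod_mult. fold c.
    assert (Hpow : 0 < 2 ^ n) by (apply pow_lt; lra).
    apply Rle_lt_trans with (c * (K / 2 ^ n)); [apply Rmult_le_compat_l; assumption|].
    replace (c * (K / 2 ^ n)) with (c * K / 2 ^ n) by (field; lra).
    apply Rlt_div_l; [exact Hpow|]. assert (H1 : c * K / eps < 2 ^ n) by lra.
    apply Rlt_div_l in H1; [|exact He]. lra.
  - rewrite <- (Cmult_1_l (Csum _ _ - _)) at 1.
    match goal with |- _ = (?u - _)%C => replace u with
      (1 / a ^ 2 * Csum (fun k => 1 / (b / a + (2 * INR k + 1)) ^ 2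
                            + 1 / (b / a - (2 * INR k + 1)) ^ 2) (2 ^ n))%C end.
    + field. auto.
    + rewrite <- Csum_scal. apply Csum_ext. intros k _.
      destruct (Hk k) as [H1 H2]. destruct (Re_odd_mult_pos a b k Hab) as [H3 H4].
      apply Re_pos_neq_0 in H3. apply Re_pos_neq_0 in H4.
      replace ((2 * INR k + 1) * a + b)%C with (a * (b / a + (2 * INR k + 1)))%C by (field; exact Ha).
      replace ((2 * INR k + 1) * a - b)%C with (- (a * (b / a - (2 * INR k + 1))))%C by (field; exact Ha).
      set (u := (b / a + (2 * INR k + 1))%C) in *. set (w := (b / a - (2 * INR k + 1))%C) in *.
      field. auto.
Qed.

Theorem corollary1 :
  forall a b : C, Rabs (Re b) < Re a ->
    is_CInt_0_infty
      (fun x : R => (Ccosh (b * x) / Csinh (a * x) * x)%C)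
      (PI ^ 2 / (4 * a ^ 2) * (1 / Csin (PI / 2 * (1 + b / a)) ^ 2))%C
    /\ (PI ^ 2 / (4 * a ^ 2) * (1 / Csin (PI / 2 * (1 + b / a)) ^ 2))%C =
       (PI ^ 2 / (4 * a ^ 2) * (1 / Ccos (PI * b / (2 * a)) ^ 2))%C.
Proof.
  intros a b Hab. assert (Hb := Rabs_pos (Re b)).
  assert (Ha : a <> 0) by (apply Re_pos_neq_0; lra).
  split.
  2:{ replace (PI / 2 * (1 + b / a))%C with (PI * b / (2 * a) + PI / 2)%C by (field; exact Ha).
      rewrite Csin_plus_PI2. reflexivity. }
  set (v := (PI ^ 2 / (4 * a ^ 2) * (1 / Csin (PI / 2 * (1 + b / a)) ^ 2))%C).
  intros P [eps HP]. unfold filtermapi.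
  (* The four quarters go to the series, the remainder integral and the boundary terms at p and q.
     The number of terms is fixed first, which is legitimate because the remainder bound is uniform
     in p and q. *)
  assert (He : 0 < eps / 4) by (assert (H := cond_pos eps); lra).
  destruct (sum_inv_sqr_odd_multiples_lim a b (eps / 4) Hab He) as [n0 Hn0]. fold v in Hn0.
  set (c := 2 * Re a ^ 2). assert (Hc : 0 < c) by (unfold c; nra).
  destruct (nfloor_ex (/ (c * (eps / 4)))) as [M HM].
  { apply Rlt_le, Rinv_0_lt_compat; nra. }
  set (n := max n0 (S M)). specialize (Hn0 n ltac:(lia)).
  (* The number of terms is 2^n = m + 1, but the remainder bound involves m; n >= M + 1 still leaves
     m > M. *)
  assert (Hm : exists m, (2 ^ n = S m)%nat /\ (M < m)%nat).
  { exists (2 ^ n - 1)%nat. assert (H0 := Nat.pow_gt_lin_r 2 n). lia. }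
  destruct Hm as [m [Em HMm]]. rewrite Em in Hn0.
  set (Sn := Csum _ _) in Hn0.
  assert (L0 := expansion_prim_lim_0 a b (S m) Hab (eps / 4) He).
  assert (L1 := expansion_prim_lim_infty a b (S m) Hab (eps / 4) He).
  (* The separating point 1 ensures 0 < p < q. *)
  apply (Filter_prod _ _ _
    (fun p => (Cmod (expansion_prim a b (S m) p + Sn) < eps / 4 /\ 0 < p) /\ p < 1)
    (fun q => Cmod (expansion_prim a b (S m) q - 0) < eps / 4 /\ 1 < q)).
  - repeat apply filter_and.
    + refine (filter_imp _ _ _ L0). intros p Hp.
      replace (expansion_prim a b (S m) p + Sn)%C
        with (expansion_prim a b (S m) p - - Sn)%C by ring.
      replace (- Sn)%C with (Csum (fun k => - (1 / ((2 * INR k + 1) * a + b) ^ 2)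
                    + - (1 / ((2 * INR k + 1) * a - b) ^ 2)) (S m))%C; [exact Hp|].
      unfold Sn. replace (- Csum _ _)%C with (-1 * Csum
        (fun k => 1 / ((2 * INR k + 1) * a + b) ^ 2 + 1 / ((2 * INR k + 1) * a - b) ^ 2) (S m))%C by ring.
      rewrite <- Csum_scal. apply Csum_ext. intros; ring.
    + exists (mkposreal 1 Rlt_0_1). auto.
    + apply filter_le_within, (open_lt 1). lra.
  - apply filter_and; [exact L1|]. exists 1. auto.
  - intros p q [[H1 Hp] Hp1] [H2 Hq]. simpl fst; simpl snd.
    destruct (integrand_RInt_approx a b m p q Hab ltac:(lia) ltac:(lra)) as [y [Hy H3]].
    exists y. split; [exact Hy|]. apply HP.
    assert (H4 : / (2 * Re a ^ 2 * INR m) < eps / 4).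
    { fold c. assert (HMm' := lt_INR _ _ HMm). apply le_INR in HMm. rewrite S_INR in HMm.
      assert (Hlt : / (c * (eps / 4)) < INR m) by lra.
      assert (Hpos : 0 < / (c * (eps / 4))) by (apply Rinv_0_lt_compat; nra).
      apply Rinv_lt_contravar in Hlt; [|nra]. rewrite Rinv_inv in Hlt.
      rewrite Rinv_mult. apply Rmult_lt_reg_l with c; [exact Hc|].
      rewrite <- Rmult_assoc, Rinv_r, Rmult_1_l by lra. exact Hlt. }
    assert (Hmod : Cmod (y - v) < eps).
    { set (Gp := expansion_prim a b (S m) p) in *.
      set (Gq := expansion_prim a b (S m) q) in *.
      replace (y - v)%C with ((y - (Gq - Gp)) + ((Gq - 0) + (- (Gp + Sn) + (Sn - v))))%C by ring.
      assert (T1 := Cmod_triangle (y - (Gq - Gp)) ((Gq - 0) + (- (Gp + Sn) + (Sn - v)))).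
      assert (T2 := Cmod_triangle (Gq - 0) (- (Gp + Sn) + (Sn - v))).
      assert (T3 := Cmod_triangle (- (Gp + Sn)) (Sn - v)). rewrite Cmod_opp in T3. lra. }
    (* The neighbourhood of v in [P] is a product ball, so each component has to be bounded by the
       modulus. *)
    assert (Hmax := Rmax_Cmod (y - v)%C).
    split.
    + change (Rabs (fst (y - v)%C) < eps).
      eapply Rle_lt_trans; [apply Rmax_l | eapply Rle_lt_trans; eassumption].
    + change (Rabs (snd (y - v)%C) < eps).
      eapply Rle_lt_trans; [apply Rmax_r | eapply Rle_lt_trans; eassumption].
Qed.
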